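(* The ALE algorithm (with two agents) has competitive ratio $1.5$ in the energy model on the class of cycles.
   Context: Multi-agent online graph exploration: an undirected connected graph $G=(V,E)$ with positive edge lengths $l(e)$ and distinctly labelled nodes is initially unknown. Agents start at a node $s$; initially they know $s$, its incident edges (with lengths) and its neighbours. Whenever an agent visits a node $v$ for the first time, all edges incident to $v$ (with lengths) and the neighbours of $v$ are revealed. Agents share all information instantly, have unlimited computation, move at unit speed, and may wait. The exploration is finished when every node has been visited and all agents are back at $s$. Energy model: the cost is the maximum total distance travelled by any single agent. $opt(G,s,k)$ is the minimum cost of an exploration by $k$ agents with full prior knowledge of $G$; an online algorithm has competitive ratio $c$ on a class if $c$ is the supremum of its cost divided by $opt(G,s,k)$ over all $G$ in the class and all $s\in V$. A cycle is a connected graph in which every node has degree 2. The ALE (Avoid-Longest-Edge) algorithm: two agents start at $s$ and are sent around the cycle in opposite directions (clockwise and counterclockwise); at each step only the agent whose next unexplored edge has smaller length traverses it (if both next edges have the same length, the one to traverse is chosen at random); when all nodes have been visited, both agents return to $s$ along shortest paths. *)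

(* Defs.v *)
From mathcomp Require Import all_boot all_order all_algebra.
From mathcomp Require Import classical_sets reals.

Set Implicit Arguments.
Unset Strict Implicit.
Unset Printing Implicit Defensive.

Import Order.TTheory GRing.Theory Num.Theory.
Local Open Scope ring_scope.

Record wgraph (R : realType) := WGraph {
  vertex :> finType;
  adj : rel vertex;
  len : vertex -> vertex -> R; (* meaningful on adjacent pairs only *)
  adj_sym : symmetric adj;
  adj_irr : irreflexive adj;
  len_sym : forall x y, len x y = len y x;
  len_gt0 : forall x y, adj x y -> 0 < len x y;
  adj_connected : forall x y, connect adj x y }.

Definition is_cycle (R : realType) (G : wgraph R) : Prop :=
  forall v : G, #|adj v| = 2.

Section Exploration.
Variables (R : realType) (G : wgraph R).

(* A walk is given by its start x and the sequence p of the nodes entered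
   after x, as in path. *)
Fixpoint walk_len (x : G) (p : seq G) : R :=
  if p is y :: q then len x y + walk_len y q else 0.

Definition dist (x y : G) : R :=
  inf [set d | exists p : seq G,
         [/\ path (@adj R G) x p, last x p = y & d = walk_len x p]]%classic.

(* Waiting costs nothing in the energy model, so a schedule of k agents is
   recorded by the k walks they perform. *)
Definition exploration (s : G) (k : nat) (w : 'I_k -> seq G) : Prop :=
  (forall i, path (@adj R G) s (w i) /\ last s (w i) = s) /\
  (forall v : G, exists i, v \in s :: w i).

Definition energy (s : G) (k : nat) (w : 'I_k -> seq G) : R :=
  \big[Num.max/0]_(i < k) walk_len s (w i).

(* The infimum is a minimum for 0 < k: lengths are positive and G is finite,
   so only finitely many walks have length below a given bound. *)
Definition opt (s : G) (k : nat) : R :=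
  inf [set c | exists2 w : 'I_k -> seq G,
         exploration s w & c = energy s w]%classic.

End Exploration.

(* cost G s is the cost incurred on G by an algorithm for k agents started
   at s. *)
Definition competitive_ratio (R : realType) (k : nat)
    (C : wgraph R -> Prop) (cost : forall G : wgraph R, G -> R) (c : R) : Prop :=
  supremums [set r : R | exists (G : wgraph R) (s : G),
               C G /\ r = cost G s / opt s k]%classic c.

Section ALE.
Variables (R : realType) (G : wgraph R).

(* On a cycle: the neighbour of v other than u, i.e. where an agent that came
   from u to v goes on to. *)
Definition onward (u v : G) : G := odflt v [pick w | adj v w && (w != u)].

Record agent := Agent { pos : G; heading : G; travelled : R }.

Definition next_len (a : agent) : R := len (pos a) (heading a).

Definition traverse (a : agent) : agent :=
  Agent (heading a) (onward (pos a) (heading a)) (travelled a + next_len a).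

Record state := State { agent1 : agent; agent2 : agent; visited : {set G} }.

(* The two agents head for the two neighbours of s; which direction is called
   clockwise is immaterial. *)
Definition ale_init (s : G) : state :=
  let x := odflt s [pick x | adj s x] in
  State (Agent s x 0) (Agent s (onward x s) 0) [set s]%SET.

(* coin is only consulted when both next edges have the same length. *)
Definition ale_step (st : state) (coin : bool) : state :=
  let: State a b A := st in
  if A == [set: G]%SET then st
  else if (next_len a < next_len b) || ((next_len a == next_len b) && coin)
  then State (traverse a) b (heading a |: A)%SET
  else State a (traverse b) (heading b |: A)%SET.

(* Until all nodes are visited every step visits a new one, so #|G| coins are
   enough to complete the run. *)
Definition ale_final (s : G) (coins : #|G|.-tuple bool) : state :=
  foldl ale_step (ale_init s) coins.

Definition total_cost (s : G) (a : agent) : R := travelled a + dist (pos a) s.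

Definition ale_cost (s : G) (coins : #|G|.-tuple bool) : R :=
  Num.max (total_cost s (agent1 (ale_final s coins)))
          (total_cost s (agent2 (ale_final s coins))).

(* Expectation over independent fair coins. *)
Definition ale_expected_cost (s : G) : R :=
  (\sum_(coins : #|G|.-tuple bool) ale_cost s coins) / 2 ^+ #|G|.

End ALE.

(* Main.v *)
(** Let L be the length of the cycle and M the length of a longest edge.
    The edge that ALE leaves unexplored is a longest one, so its two agents
    together travel L - M before they turn back, and going home from a node v costs dist v s.
    Offline, any two edges separate the cycle, which forces opt >= L - M, and a
    closed walk through v has length at least 2 dist v s; so ALE pays at most
    opt + opt / 2.  On the triangle with edge lengths 1, 1 - e, 1 - e started
    at an end of the edge of length 1, ALE pays at least 3 - 2e, whereas opt
    is at most 2. *)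

Require Import Defs.
From mathcomp Require Import all_boot all_order all_algebra.
From mathcomp Require Import classical_sets reals.
From mathcomp Require Import zify lra.

Import Order.TTheory GRing.Theory Num.Theory.
Local Open Scope ring_scope.

(** * Cycles as periodic sequences of nodes *)

Section Cycles.
Variables (R : realType) (G : wgraph R).
Implicit Types (s u v w x : G) (p q : seq G).

Lemma cycle_adjE v a b : is_cycle G -> adj v a -> adj v b -> a != b ->
  forall c, adj v c = (c == a) || (c == b).
Proof.
move=> cG va vb ab c; have sub : [set a; b]%SET \subset adj v.
  by apply/fintype.subsetP => z; rewrite !inE => /orP[] /eqP->.
have /subset_cardP/(_ sub)/(_ c) : #|[set a; b]%SET| = #|adj v|.
  by rewrite cards2 ab cG.
by rewrite !inE => ->.
Qed.

Lemma onwardP u v : is_cycle G -> adj v u ->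
  adj v (onward u v) /\ onward u v != u.
Proof.
move=> cG vu; rewrite /onward; case: pickP => [z /andP[]|none] //=.
have := cG v; rewrite (cardD1 u) (_ : u \in adj v = true) //.
rewrite (eq_card0 (A := [predD1 adj v & u])) // => z.
by have := none z; rewrite !inE andbC.
Qed.

Lemma onwardE u v w : is_cycle G -> adj v u -> adj v w -> u != w ->
  onward u v = w.
Proof.
move=> cG vu vw uw; have [vo ou] := onwardP u v cG vu.
by move: vo; rewrite (cycle_adjE _ _ _ cG vu vw uw) (negPf ou) => /eqP.
Qed.

(** Indices run over all of [nat], with period [n], so that stepping past the last node needs no
    case split. Edge [k < n] joins [y k] and [y k.+1]; edge [n - 1] leads back to [y 0]. *)
Definition tour (n : nat) (y : nat -> G) : Prop :=
  [/\ (2 < n)%N, forall k, adj (y k) (y k.+1),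
      forall j k, (y j == y k) = (j == k %[mod n])
    & forall v, exists k, v = y k].

(** Walking on without turning back must repeat a node. The first node to recur can only be [s],
    since a return to any other node would give it a third neighbour. From there the walk repeats
    itself, and by connectedness it meets every node. *)
Lemma tour_exists s x : is_cycle G -> adj s x ->
  exists n y, [/\ tour n y, y 0 = s & y 1 = x].
Proof.
move=> cG sx.
pose next d : G * G := (d.2, onward d.1 d.2).
pose y k := (iter k next (s, x)).1.
have yS k : y k.+1 = (iter k next (s, x)).2 by [].
have ySS k : y k.+2 = onward (y k) (y k.+1) by [].
have yadj k : adj (y k) (y k.+1).
  elim: k => [|k IH] //; rewrite ySS.
  by have [] := onwardP (y k) (y k.+1) cG; rewrite ?[adj _ (y k)]adj_sym.
have yadj' k : adj (y k.+1) (y k) by rewrite adj_sym.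
have yne k : y k != y k.+2.
  by rewrite eq_sym ySS; have [] := onwardP (y k) (y k.+1) cG (yadj' k).
have yN k c : adj (y k.+1) c -> c = y k \/ c = y k.+2.
  rewrite (cycle_adjE _ (y k) (y k.+2) cG) //.
  by case/orP=> /eqP; [left | right].
(* [n] is the length of the longest repetition-free prefix; more than [#|G|] nodes cannot be
   distinct. *)
have [n []] : exists n, y n \in [seq y i | i <- iota 0 n] /\
    uniq [seq y i | i <- iota 0 n].
  have [m nu] : exists m, ~~ uniq [seq y i | i <- iota 0 m].
    exists #|G|.+1; apply/negP => /card_uniqP c.
    by have := max_card (mem [seq y i | i <- iota 0 #|G|.+1]);
      rewrite c size_map size_iota ltnn.
  elim: m nu => [|m IH] //; rewrite -addn1 iotaD map_cat cat_uniq /= !andbT orbF.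
  case: (boolP (uniq _)) => [um|/IH//]; rewrite negbK => ym.
  by exists m; split.
case/mapP => j; rewrite mem_iota /= add0n => jn ynj un.
have yinj a b : (a < n)%N -> (b < n)%N -> y a = y b -> a = b.
  move=> an bn e; have := nth_uniq s (i:=a) (j:=b) _ _ un.
  rewrite size_map size_iota !(nth_map 0%N) ?size_iota // !nth_iota // !add0n e.
  by rewrite eqxx => /(_ an bn)/esym/eqP.
have n2 : (2 < n)%N.
  have nj1 : n <> j.+1.
    by move=> e; have := yadj j; rewrite -e ynj adj_irr.
  have nj2 : n <> j.+2.
    by move=> e; have := yne j; rewrite -e ynj eqxx.
  lia.
(* For [j > 0], [y n.-1] would be one of the two neighbours of [y j] on the walk, which injectivity
   and the absence of backtracking exclude. *)
have j0 : j = 0%N.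
  case: j jn ynj => [//|j] jn ynj.
  have := yadj' n.-1; rewrite prednK; last by lia.
  rewrite ynj => /yN[] e.
    by have := yinj n.-1 j ltac:(lia) ltac:(lia) e; lia.
  have [nj|nj] := eqVneq n j.+2.
    by have := yadj j.+1; rewrite -nj ynj adj_irr.
  have nj' := yinj n.-1 j.+2 ltac:(lia) ltac:(lia) e.
  by have := yne j.+1; rewrite -ynj -nj' prednK ?eqxx//; lia.
rewrite {}j0 {jn j} in ynj.
have y0N c : adj (y 0) c -> c = y n.-1 \/ c = y 1.
  rewrite (cycle_adjE _ (y n.-1) (y 1) cG) //.
  - by case/orP=> /eqP; [left | right].
  - by rewrite -ynj -{1}(prednK (_ : 0 < n)%N) //; lia.
  - by apply/eqP => /yinj-/(_ ltac:(lia) ltac:(lia)); lia.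
(* Arriving at [y 0] from [y n.-1], the only way on without turning back is [y 1]. *)
have yn1 : y n.+1 = y 1.
  have := yadj n; rewrite ynj => /y0N[] // e.
  by have := yne n.-1; rewrite prednK ?e ?eqxx //; lia.
have yper k : y (n + k)%N = y k /\ y (n + k).+1 = y k.+1.
  elim: k => [|k [IH IH1]]; first by rewrite addn0.
  by rewrite addnS; split=> //; rewrite !ySS IH IH1.
have ymul m k : y (m * n + k)%N = y k.
  elim: m => [|m IH] //; rewrite mulSn -addnA.
  by have [-> _] := yper (m * n + k)%N.
have ymod k : y k = y (k %% n)%N by rewrite {1}(divn_eq k n) ymul.
exists n, y; split => //; split => //.
- move=> i k; apply/eqP/eqP => [|e]; last by rewrite ymod e -ymod.
  by rewrite (ymod i) (ymod k) => /yinj->//; rewrite ltn_mod; lia.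
(* The nodes of the walk are closed under adjacency: induction along a path from [s]. *)
- move=> v; have /connectP[p] := adj_connected s v.
  have : exists k, s = y k by exists 0%N.
  elim: p (s) => [|z p IH] t /= [k tk]; first by move=> _ ->; exists k.
  case/andP=> tz /IH zp /zp; apply.
  case: k tk tz => [|k] ->; first by case/y0N; [exists n.-1 | exists 1%N].
  by case/yN; [exists k | exists k.+2].
Qed.

Lemma tour_inj n y a b : tour n y -> (a < n)%N -> (b < n)%N ->
  (y a == y b) = (a == b).
Proof. by case=> _ _ -> _ an bn; rewrite !modn_small. Qed.

Lemma tour_period n y k : tour n y -> y (n + k)%N = y k.
Proof. by case=> _ _ yE _; apply/eqP; rewrite yE modnDl. Qed.

Lemma tour_surj n y v : tour n y -> exists2 k, (k < n)%N & v = y k.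
Proof.
case=> n2 _ yE ysurj; have [k ->] := ysurj v.
exists (k %% n)%N; first by rewrite ltn_mod; lia.
by apply/eqP; rewrite yE modn_mod.
Qed.

Lemma tour_adj n y u v : is_cycle G -> tour n y -> adj u v ->
  exists2 k, (k < n)%N & u = y k /\ v = y k.+1 \/ u = y k.+1 /\ v = y k.
Proof.
move=> cG ty; have [n2 yadj yE _] := ty.
have [a an ->] := tour_surj n y u ty.
(* The predecessor of [a] modulo [n], shifted by [n] so that the subtraction is not truncated at
   0. *)
pose b := (n + a).-1; have bS : y b.+1 = y a.
  by rewrite /b prednK ?(tour_period n y a ty) //; lia.
rewrite (cycle_adjE (y a) (y b) (y a.+1) cG) //.
- case/orP=> /eqP->; last by exists a => //; left.
  exists (b %% n)%N; first by rewrite ltn_mod; lia.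
  right; split; apply/eqP.
    by rewrite -bS yE -addn1 -[(b %% n).+1]addn1 modnDml.
  by rewrite yE modn_mod.
- by rewrite -bS adj_sym.
- have -> : y a.+1 = y b.+2.
    by apply/eqP; rewrite yE prednK; [rewrite -addnS modnDl | lia].
  rewrite yE -addn2 -{1}[b]addn0 eqn_modDl mod0n modn_small //; lia.
Qed.

(** * Parity of edge traversals *)

Definition joins (y : nat -> G) (k : nat) : rel G := fun u v =>
  (u == y k) && (v == y k.+1) || (u == y k.+1) && (v == y k).

Lemma joins_sym y k u v : joins y k u v = joins y k v u.
Proof. by rewrite /joins orbC ![(v == _) && _]andbC. Qed.

(** A match in the reverse direction would need [a = k + 1] and [k = a + 1] modulo [n], so [n] would
    divide 2. *)
Lemma joinsE n y a k : tour n y -> (a < n)%N -> (k < n)%N ->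
  joins y k (y a) (y a.+1) = (a == k).
Proof.
move=> ty an kn; have [n2 _ yE _] := ty; rewrite /joins !yE.
have -> : (a.+1 == k.+1 %[mod n]) = (a == k %[mod n]).
  by rewrite -addn1 -[k.+1]addn1 eqn_modDr.
rewrite andbb orbC.
case: (boolP (_ && _)) => [/andP[/eqP ak /eqP ka]|_]; last by rewrite !modn_small.
have : (k + 2 == k + 0 %[mod n]).
  by rewrite addn0 -ka -[a.+1]addn1 addnS addn1 -[k.+2]addn1 eqn_modDr ak.
by rewrite eqn_modDl mod0n modn_small.
Qed.

Definition traversals (y : nat -> G) (k : nat) (x : G) (p : seq G) : nat :=
  count id (pairmap (joins y k) x p).

Lemma traversals_cat y k x p q : traversals y k x (p ++ q) =
  (traversals y k x p + traversals y k (last x p) q)%N.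
Proof. by rewrite /traversals pairmap_cat count_cat. Qed.

(** Exactly one term is nonzero; the sum form lets the length of a walk be regrouped by edges. *)
Lemma len_joins n y u v : is_cycle G -> tour n y -> adj u v ->
  len u v = \sum_(k < n) (joins y k u v)%:R * len (y k) (y k.+1).
Proof.
move=> cG ty uv; have [a an auv] := tour_adj n y u v cG ty uv.
have E k : (k < n)%N -> joins y k u v = (a == k).
  by move=> kn; case: auv => -[-> ->]; last rewrite joins_sym; rewrite (joinsE n).
rewrite (bigD1 (Ordinal an)) //= E // eqxx mul1r big1 => [|k ka].
  by rewrite addr0; case: auv => -[-> ->] //; rewrite len_sym.
by rewrite E // eq_sym -[a]/(val (Ordinal an)) val_eqE (negPf ka) mul0r.
Qed.

Lemma walk_len_traversals n y x p : is_cycle G -> tour n y ->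
  path (@adj R G) x p ->
  walk_len x p =
  \sum_(k < n) (traversals y k x p)%:R * len (y k) (y k.+1).
Proof.
move=> cG ty; elim: p x => [|z p IH] x /=.
  by rewrite big1 // => k; rewrite mul0r.
case/andP=> xz /IH ->; rewrite (len_joins n y x z cG ty xz) -big_split /=.
by apply: eq_bigr => k _; rewrite -mulrDl -natrD.
Qed.

(* Removing the edges j < k from the cycle isolates the nodes y a, j < a <= k. *)
Definition arc (n : nat) (y : nat -> G) (j k : nat) : pred G :=
  fun v => [exists a : 'I_n, (j < a <= k)%N && (v == y a)].

Lemma arcE n y j k a : tour n y -> (a < n)%N ->
  arc n y j k (y a) = (j < a <= k)%N.
Proof.
move=> ty an; apply/existsP/idP => [[b /andP[jbk]]|jak].
  by rewrite (tour_inj n y a b ty an) // => /eqP->.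
by exists (Ordinal an); rewrite jak /=.
Qed.

(** Moving from index [a] to [a + 1] changes membership in the arc exactly at [a = j] and
    [a = k]. *)
Lemma arc_joins n y j k u v : is_cycle G -> tour n y -> adj u v ->
  (j < k < n)%N ->
  arc n y j k u (+) arc n y j k v = joins y j u v (+) joins y k u v.
Proof.
move=> cG ty uv /andP[jk kn]; have [n2 _ _ _] := ty.
have jn := ltn_trans jk kn.
wlog [a an [-> ->]] : u v {uv} / exists2 a, (a < n)%N & u = y a /\ v = y a.+1.
  move=> IH; have [a an [auv|auv]] := tour_adj n y u v cG ty uv.
    by apply: IH; exists a.
  by rewrite addbC ![joins _ _ u v]joins_sym; apply: IH; exists a; case: auv.
rewrite !(joinsE n) // arcE //; case: (ltnP a.+1 n) => an1.
  by rewrite arcE //; lia.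
(* The wrap-around edge ends at [y 0], which lies outside the arc because [j < 0] fails. *)
have -> : y a.+1 = y 0 by rewrite -(tour_period n y 0 ty); congr y; lia.
by rewrite (arcE n y j k 0 ty); lia.
Qed.

(** Summed over the walk, the changes of side telescope modulo 2. *)
Lemma odd_traversals n y j k x p : is_cycle G -> tour n y ->
  (j < k < n)%N -> path (@adj R G) x p ->
  odd (traversals y j x p) (+) odd (traversals y k x p) =
  arc n y j k x (+) arc n y j k (last x p).
Proof.
move=> cG ty jkn; elim: p x => [|z p IH] x /=; first by rewrite addbb.
case/andP=> xz /IH; rewrite /traversals /= !oddD !oddb addbACA => ->.
by rewrite -(arc_joins n) // addbA addbK.
Qed.

(** The part of the walk up to [v] changes sides, so it crosses the two edges an odd number of times
    in total. *)
Lemma traversals_gt0 n y j k x p v : is_cycle G -> tour n y ->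
  (j < k < n)%N -> path (@adj R G) x p -> v \in x :: p ->
  arc n y j k v != arc n y j k x ->
  (0 < traversals y j x p + traversals y k x p)%N.
Proof.
move=> cG ty jkn xp vp; case/splitPl: vp xp => p1 p2 <-.
rewrite cat_path => /andP[xp1 _]; rewrite !traversals_cat.
have := odd_traversals n y j k x p1 cG ty jkn xp1.
case: (arc _ _ _ _ _); case: (arc _ _ _ _ _) => //=;
  case: (traversals y j x p1); case: (traversals y k x p1); lia.
Qed.

(** * Lower bound on the energy of an exploration *)

Lemma walk_len_le_energy s k (w : 'I_k -> seq G) i :
  walk_len s (w i) <= energy s w.
Proof. exact: (le_bigmax _ (fun i => walk_len s (w i))). Qed.

(* The two edges j < k separate the cycle, so every closed walk crosses them an
   even number of times in total, and some agent has to cross one of them.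
   Hence either one agent uses every edge, or every edge but one is crossed
   at least twice by the two agents together. *)
Lemma energy_ge n y m s (w : 'I_2 -> seq G) : is_cycle G -> tour n y ->
  (m < n)%N ->
  (forall k, (k < n)%N -> len (y k) (y k.+1) <= len (y m) (y m.+1)) ->
  exploration s w ->
  \sum_(k < n) len (y k) (y k.+1) - len (y m) (y m.+1) <= energy s w.
Proof.
move=> cG ty mn mmax [ws wv]; have [n2 yadj _ _] := ty.
set l := fun k => len (y k) (y k.+1).
have l0 k : 0 < l k by apply: len_gt0.
have n0 : (0 < n)%N by lia.
pose c i k := traversals y k s (w i).
have wE i : walk_len s (w i) = \sum_(k < n) (c i k)%:R * l k.
  by apply: walk_len_traversals => //; have [] := ws i.
(* The walk is closed, so it ends on the side where it began, and every edge has the parity of edge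
   0. *)
have par i k : (k < n)%N -> odd (c i k) = odd (c i 0%N).
  case: k => [//|k] kn; have [sp sl] := ws i.
  have := odd_traversals n y 0 k.+1 s (w i) cG ty kn sp.
  by rewrite sl addbb /c; do 2 case: (odd _).
(* Odd counts are nonzero: agent [i] then uses every edge and travels at least the whole cycle. *)
case: (boolP [exists i, odd (c i 0%N)]) => [/existsP[i oi]|].
  apply: le_trans (walk_len_le_energy s 2 w i); rewrite wE lerBlDr.
  apply: ler_wpDr; first exact: ltW (l0 m).
  apply: ler_sum => k _; rewrite (ler_peMl (ltW (l0 k))) // ler1n.
  by have := par i k (ltn_ord k); rewrite oi; case: (c i k).
rewrite negb_exists => /forallP ev.
pose C k := (\sum_(i < 2) c i k)%N.
have Cev k : (k < n)%N -> ~~ odd (C k).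
  move=> kn; rewrite /C !big_ord_recl big_ord0 addn0 oddD !par //.
  by rewrite (negPf (ev _)) (negPf (ev _)).
have Cpos j k : (j < k < n)%N -> (0 < C j + C k)%N.
  move=> jkn; have [v vs] : exists v, arc n y j k v != arc n y j k s.
    case: (boolP (arc n y j k s)) => _.
      by exists (y 0); rewrite (arcE n y j k 0 ty n0).
    by exists (y k); rewrite (arcE n) //; lia.
  have [i vi] := wv v; have [sp _] := ws i.
  have := traversals_gt0 n y j k s (w i) v cG ty jkn sp vi vs.
  rewrite -/(c i j) -/(c i k) => cjk.
  by rewrite /C -big_split (bigD1 i) //= ltn_addr.
(* At most one edge is never crossed; it is taken for [z]. If there is none, any index serves, here
   [m]. *)
have [z [zn Cz]] : exists z, (z < n)%N /\
    forall k, (k < n)%N -> k != z -> (1 < C k)%N.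
  case: (boolP [exists z : 'I_n, C z == 0%N]) => [/existsP[z /eqP z0]|].
    exists z; split => // k kn kz; have := Cev k kn.
    have : (0 < C z + C k)%N.
      by case: (ltngtP k z) kz => // kz _; [rewrite addnC|];
        apply: Cpos; rewrite kz //=.
    by rewrite z0; case: (C k) => [|[]].
  rewrite negb_exists => /forallP nz; exists m; split=> // k kn _.
  by have := Cev k kn; have := nz (Ordinal kn); rewrite /=; case: (C k) => [|[]].
have le2 : \sum_(i < 2) walk_len s (w i) <= 2 * energy s w.
  rewrite mulr_natl -[X in _ *+ X](card_ord 2) -sumr_const.
  by apply: ler_sum => i _; apply: walk_len_le_energy.
have ge2 : 2 * (\sum_(k < n) l k - l z) <= \sum_(i < 2) walk_len s (w i).
  rewrite (eq_bigr _ (fun i _ => wE i)) exchange_big.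
  rewrite [X in _ * (X - _)](bigD1 (Ordinal zn)) //= [l z + _]addrC addrK mulr_sumr.
  rewrite [X in _ <= X](bigD1 (Ordinal zn)) //= ler_wpDl //.
    by apply: sumr_ge0 => i _; exact: mulr_ge0 (ltW (l0 _)).
  apply: ler_sum => k kz; rewrite -mulr_suml -natr_sum (ler_wpM2r (ltW (l0 k))) //.
  by rewrite ler_nat; apply: Cz.
have := mmax z zn; rewrite -/(l z) -/(l m); lra.
Qed.

(** * Distances and lower bounds on [opt] *)

Lemma walk_len_ge0 x p : path (@adj R G) x p -> 0 <= walk_len x p.
Proof.
elim: p x => //= z p IH x /andP[xz /IH]; apply: addr_ge0.
exact: ltW (len_gt0 xz).
Qed.

Lemma walk_len_cons x z p : walk_len x (z :: p) = len x z + walk_len z p.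
Proof. by []. Qed.

Lemma walk_len_cat x p q :
  walk_len x (p ++ q) = walk_len x p + walk_len (last x p) q.
Proof. by elim: p x => [|z p IH] x /=; rewrite ?add0r // IH addrA. Qed.

Lemma walk_rev x p : path (@adj R G) x p ->
  [/\ path (@adj R G) (last x p) (rev (belast x p)),
      last (last x p) (rev (belast x p)) = x
    & walk_len (last x p) (rev (belast x p)) = walk_len x p].
Proof.
move=> xp; split.
- rewrite rev_path; congr (is_true _): xp.
  by apply: eq_path => u v; rewrite adj_sym.
- by case: p {xp} => //= z p; rewrite rev_cons last_rcons.
elim: p x {xp} => [|z p IH] x //=.
rewrite rev_cons -cats1 walk_len_cat IH addrC /= addr0; congr (_ + _).
by case: p {IH} => [|t p] /=; rewrite ?rev_cons ?last_rcons len_sym.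
Qed.

Lemma dist_le x p : path (@adj R G) x p -> dist x (last x p) <= walk_len x p.
Proof.
move=> xp; apply: ge_inf; last by exists p.
by exists 0 => _ [q [xq _ ->]]; apply: walk_len_ge0.
Qed.

(** Cutting the walk at [v] gives two walks between [v] and [s]; the first one is reversed. *)
Lemma dist_closed_walk s p v : path (@adj R G) s p -> last s p = s ->
  v \in s :: p -> 2 * dist v s <= walk_len s p.
Proof.
move=> sp ls vp; case/splitPl: vp sp ls => p1 p2 <- {v}.
rewrite cat_path walk_len_cat last_cat => /andP[sp1 sp2] ls.
have := dist_le _ _ sp2; have [r1 r2 r3] := walk_rev _ _ sp1.
have := dist_le _ _ r1; rewrite ls r2 r3; lra.
Qed.

(** The infimum of an empty set would be a default value, so an exploration has to be exhibited:
    both agents go once round the tour. *)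
Lemma opt_ge s c : is_cycle G ->
  (forall w : 'I_2 -> seq G, exploration s w -> c <= energy s w) ->
  c <= opt s 2.
Proof.
move=> cG le_c; apply: lb_le_inf; last by move=> _ [w ew ->]; apply: le_c.
have [x sx] : exists x, adj s x.
  by have := cG s; case: (pickP (adj s)) => [x|/eq_card0->] //; exists x.
have [n [y [ty y0 _]]] := tour_exists s x cG sx.
have tp a m : path (@adj R G) (y a) [seq y i | i <- iota a.+1 m] /\
    last (y a) [seq y i | i <- iota a.+1 m] = y (a + m)%N.
  elim: m a => [|m IH] a /=; first by rewrite addn0.
  by have [-> ->] := IH a.+1; case: ty => _ -> _ _; rewrite addSnnS.
pose w (_ : 'I_2) := [seq y i | i <- iota 1 n].
exists (energy s w); exists w => //; split=> [i|v].
  have [p l] := tp 0%N n; rewrite /w -y0; split=> //.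
  by rewrite l add0n -[n]addn0 (tour_period n).
exists ord0; have [[|k] kn ->] := tour_surj n y v ty; first by rewrite y0 mem_head.
by rewrite inE; apply/orP; right; apply: map_f; rewrite mem_iota; lia.
Qed.

Lemma opt_ge_dist s v : is_cycle G -> 2 * dist v s <= opt s 2.
Proof.
move=> cG; apply: opt_ge => // w [ws /(_ v)[i vi]].
have [sp sl] := ws i.
exact: le_trans (dist_closed_walk _ _ _ sp sl vi) (walk_len_le_energy s 2 w i).
Qed.

(** * Upper bound for ALE *)

(* Agent 1 stands at y i and agent 2 at y (n - j), so that the edges with
   indices from i to n - j - 1 are unexplored; a longest edge is among them. *)
Definition ale_inv (n : nat) (y : nat -> G) (i j : nat) (st : state G) : Prop :=
  [/\ (i + j < n)%N,
      agent1 st = Agent (y i) (y i.+1) (\sum_(0 <= k < i) len (y k) (y k.+1)),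
      agent2 st = Agent (y (n - j)%N) (y (n - j).-1)
                        (\sum_(n - j <= k < n) len (y k) (y k.+1)),
      forall m, (m < n)%N -> (m <= i)%N || (n - j <= m)%N -> y m \in visited st
    & exists2 k, (i <= k < n - j)%N & forall m, (m < n)%N ->
        len (y m) (y m.+1) <= len (y k) (y k.+1)].

(** The tour is oriented by the first edge of agent 1, so agent 2 runs through it backwards from
    [y n = y 0]. *)
Lemma ale_init_inv s : is_cycle G ->
  exists n y, tour n y /\ ale_inv n y 0 0 (ale_init s).
Proof.
move=> cG; rewrite /ale_init.
case: pickP => [x sx|none] /=; last first.
  by have := cG s; rewrite (eq_card0 none).
have [n [y [ty y0 y1]]] := tour_exists s x cG sx; exists n, y; split=> //.
have [n2 yadj yE _] := ty.
have n0 : (0 < n)%N by lia.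
have yn : y n = s by rewrite -y0 -(tour_period n y 0 ty) addn0.
have ox : onward x s = y n.-1.
  apply: onwardE => //; first by rewrite -{1}yn -{1}(prednK n0) adj_sym.
  by rewrite -y1 (tour_inj n) //; lia.
split; rewrite ?subn0 //=.
- by rewrite y0 y1 big_geq.
- by rewrite yn ox big_geq.
- by move=> m mn; rewrite leqn0 leqNgt mn orbF => /eqP->; rewrite y0 set11.
have [k _ kmax] := @arg_maxP _ _ _ (Ordinal n0) xpredT
  (fun k : 'I_n => len (y k) (y k.+1)) isT.
by exists k; rewrite ?ltn_ord //= => m mn; apply: (kmax (Ordinal mn)).
Qed.

(** If the step uses up the longest edge [k], the next edge of the other agent is at least as long,
    by the comparison just made, and replaces [k]. *)
Lemma ale_step_inv n y i j st c : is_cycle G -> tour n y ->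
  ale_inv n y i j st -> exists i' j', ale_inv n y i' j' (ale_step st c).
Proof.
case: st => a b A cG ty [/= ijn -> -> vA [k kij kmax]].
have [n2 yadj yE _] := ty.
case: ifPn => [_|AT]; first by exists i, j; split=> //; exists k.
have yadj' t : adj (y t.+1) (y t) by rewrite adj_sym.
have yne t : y t != y t.+2.
  by rewrite yE -addn2 -{1}[t]addn0 eqn_modDl mod0n modn_small.
(* Were a single edge left unexplored, all nodes would have been visited. *)
have ij1 : (i + j < n.-1)%N.
  rewrite ltnNge; apply: contra AT => ge; apply/eqP/setP => v; rewrite inE.
  have [m mn ->] := tour_surj n y v ty; apply: vA => //; lia.
(* Agent 2 now stands at [y t.+2], and its next edge has index [t.+1]. *)
have [t jt] : exists t, (n - j = t.+2)%N by exists (n - j - 2)%N; lia.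
have tn : (t.+1 < n)%N by lia.
rewrite jt /= in kij vA *; rewrite /next_len /traverse /=.
case: ifP => [ab|ab].
  exists i.+1, j; split=> /=; rewrite ?jt //.
  - by lia.
  - by rewrite (onwardE (y i) _ (y i.+2)) // big_nat_recr.
  - move=> m mn; rewrite leq_eqVlt ltnS -orbA => /predU1P[->|mi].
      exact: setU11.
    by apply/setU1P; right; apply: vA.
  have [ki|ki] := eqVneq k i; last by exists k => //; lia.
  exists t.+1; first by lia.
  move=> m /kmax le_m; apply: le_trans le_m _; rewrite ki [leRHS]len_sym.
  by case/orP: ab => [/ltW|/andP[/eqP->]].
exists i, j.+1; have jt' : (n - j.+1 = t.+1)%N by lia.
split=> /=; rewrite ?jt' //.
- by lia.
- rewrite (onwardE (y t.+2) _ (y t)) ?yadj // 1?eq_sym //.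
  by rewrite [in RHS]big_ltn // addrC len_sym.
- move=> m mn mij; case: (eqVneq m t.+1) => [->|mt]; first exact: setU11.
  by apply/setU1P; right; apply: vA => //; lia.
have [kt|kt] := eqVneq k t.+1; last by exists k => //; lia.
exists i; first by lia.
move=> m /kmax le_m; apply: le_trans le_m _; rewrite kt len_sym.
by move: ab => /negbT; rewrite negb_or -leNgt => /andP[].
Qed.

(** The edges travelled by one agent do not include [k], so they sum to at most [opt]; the way home
    costs at most [opt / 2]. *)
Lemma ale_cost_le s (coins : #|G|.-tuple bool) : is_cycle G ->
  ale_cost s coins <= 3 / 2 * opt s 2.
Proof.
move=> cG; have [n [y [ty inv0]]] := ale_init_inv s cG.
have [i [j]] : exists i j, ale_inv n y i j (ale_final s coins).
  rewrite /ale_final; move: inv0; move: (ale_init s) {1}0%N {1}0%N.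
  elim: (tval coins) => [|c cs IH] st j i inv /=; first by exists i, j.
  have [i' [j' inv']] := ale_step_inv n y i j st c cG ty inv.
  exact: IH inv'.
rewrite /ale_cost /total_cost => -[ijn -> -> _ [k /andP[ik kj] kmax]] /=.
have [_ yadj _ _] := ty.
have kn : (k < n)%N by lia.
have l0 m : 0 <= len (y m) (y m.+1) by apply: ltW; apply: len_gt0.
have sum0 a b : 0 <= \sum_(a <= m < b) len (y m) (y m.+1).
  by apply: sumr_ge0.
have := opt_ge s _ cG (fun ws => energy_ge n y k s ws cG ty kn kmax).
(* Splitting the sum at [i], [k] and [n - j] isolates the longest edge and the two explored
   stretches. *)
rewrite -(big_mkord xpredT (fun m => len (y m) (y m.+1))).
rewrite (big_cat_nat (n := k)) ?(ltnW kn) //= (big_cat_nat (n := i)) //=.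
rewrite (big_ltn kn) (big_cat_nat (m := k.+1) (n := (n - j)%N)) ?leq_subr //=.
have := opt_ge_dist s (y i) cG; have := opt_ge_dist s (y (n - j)%N) cG.
have := sum0 0%N i; have := sum0 i k; have := sum0 k.+1 (n - j)%N.
have := sum0 (n - j)%N n; rewrite ge_max => *; apply/andP; split; lra.
Qed.

End Cycles.

(** * Tightness on a triangle *)

Section Triangle.
Variables (R : realType) (e : R).
Hypotheses (e_gt0 : 0 < e) (e_le : e <= 1 / 2).

(** ALE prefers the two edges at [ord_max] and is thus led by a detour from one end of the edge of
    length 1 to the other. *)
Definition triangle_len (x y : 'I_3) : R :=
  if (x == ord_max) || (y == ord_max) then 1 - e else 1.

Lemma triangle_sym : symmetric (fun x y : 'I_3 => x != y).
Proof. by move=> x y; rewrite eq_sym. Qed.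

Lemma triangle_irr : irreflexive (fun x y : 'I_3 => x != y).
Proof. by move=> x; rewrite eqxx. Qed.

Lemma triangle_len_sym x y : triangle_len x y = triangle_len y x.
Proof. by rewrite /triangle_len orbC. Qed.

Lemma triangle_len_gt0 x y : x != y -> 0 < triangle_len x y.
Proof. by rewrite /triangle_len; case: ifP => _ _; have := e_le; lra. Qed.

Lemma triangle_connected (x y : 'I_3) : connect (fun x y => x != y) x y.
Proof. by case: (eqVneq x y) => [->//|xy]; apply: connect1. Qed.

Definition triangle : wgraph R := WGraph triangle_sym triangle_irr
  triangle_len_sym triangle_len_gt0 triangle_connected.

Let v0 : triangle := inord 0.
Let v1 : triangle := inord 1.
Let v2 : triangle := inord 2.

Lemma triangle_cycle : is_cycle triangle.
Proof.
move=> v; rewrite -(eq_card (A := predC1 v)); first by rewrite cardC1 card_ord.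
by move=> w; rewrite !inE eq_sym.
Qed.

Lemma triangle_cases (P : triangle -> Prop) : P v0 -> P v1 -> P v2 -> forall v, P v.
Proof.
move=> P0 P1 P2; case=> -[|[|[|//]]] /= i3.
- by rewrite (_ : Ordinal _ = v0) //; apply: val_inj; rewrite /= inordK.
- by rewrite (_ : Ordinal _ = v1) //; apply: val_inj; rewrite /= inordK.
- by rewrite (_ : Ordinal _ = v2) //; apply: val_inj; rewrite /= inordK.
Qed.

Let v01 : (v0 == v1) = false. Proof. by rewrite -val_eqE /= !inordK. Qed.
Let v02 : (v0 == v2) = false. Proof. by rewrite -val_eqE /= !inordK. Qed.
Let v12 : (v1 == v2) = false. Proof. by rewrite -val_eqE /= !inordK. Qed.
Let vE := (v01, v02, v12, eqxx, eq_sym v1 v0, eq_sym v2 v0, eq_sym v2 v1).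

Lemma triangle_adjE (x y : triangle) : adj x y = (x != y).
Proof. by []. Qed.

Lemma triangle_lenE (x y : triangle) :
  len x y = if (x == v2) || (y == v2) then 1 - e else 1.
Proof.
rewrite /= /triangle_len (_ : ord_max = v2) //.
by apply: val_inj; rewrite /= inordK.
Qed.

Lemma triangle_onward (x y z : triangle) : x != y -> y != z -> x != z ->
  onward x y = z.
Proof.
move=> xy yz xz; apply: onwardE => //; first exact: triangle_cycle.
by rewrite triangle_adjE eq_sym.
Qed.

(** A walk that does not start with the direct edge starts with two edges at [v2], of total length 2
    - 2e, which is at least 1. *)
Lemma triangle_dist : 1 <= dist v1 v0.
Proof.
apply: lb_le_inf.
  exists (len v1 v0), [:: v0]; split.
  - by apply/andP; rewrite triangle_adjE !vE.
  - by [].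
  - by rewrite [RHS]addr0.
move=> _ [p [+ + ->]]; case: p => [_ /eqP|z p]; first by rewrite [last _ _]/= !vE.
rewrite walk_len_cons => /andP[+ zp] lz.
have := walk_len_ge0 _ _ _ _ zp; rewrite triangle_lenE triangle_adjE.
elim/triangle_cases: z zp lz => zp lz; rewrite !vE //=; first by lra.
case: p zp lz => [_ /eqP|t p /andP[_ tp] _]; first by rewrite [last _ _]/= !vE.
rewrite walk_len_cons triangle_lenE !vE.
have := walk_len_ge0 _ _ _ _ tp; have := e_le; rewrite /=; lra.
Qed.

(** Each agent goes out and back along one edge at [v0]. *)
Lemma triangle_opt : opt v0 2 <= 2.
Proof.
pose w (i : 'I_2) : seq triangle := if i == ord0 then [:: v1; v0] else [:: v2; v0].
have ew : exploration v0 w.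
  split=> [i|v]; last first.
    elim/triangle_cases: v; [exists ord0|exists ord0|exists ord_max];
    by rewrite /w /= !inE !vE.
  rewrite /w; case: ifP => _; split=> //; apply/and3P; by rewrite !triangle_adjE !vE.
apply: le_trans (_ : energy v0 w <= 2).
  apply: ge_inf; last by exists w.
  exists 0 => _ [u [uw _] ->]; have [p _] := uw ord0.
  exact: le_trans (walk_len_ge0 _ _ _ _ p) (walk_len_le_energy _ _ _ _ u ord0).
apply: bigmax_le => // i _; rewrite /w.
by case: ifP => _; rewrite !walk_len_cons !triangle_lenE !vE /=;
  have := e_gt0; lra.
Qed.

(** The unvisited [v1] keeps the run going, and the strict comparison settles the step for either
    coin. *)
Lemma triangle_step1 a b (A : {set triangle}) c : v1 \notin A ->
  next_len a = 1 - e -> next_len b = 1 ->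
  ale_step (State a b A) c = State (traverse a) b (heading a |: A)%SET.
Proof.
move=> v1A la lb; rewrite /ale_step la lb ifF; last first.
  by apply: contraNF v1A => /eqP->; rewrite inE.
by rewrite ifT // gtrDl oppr_lt0 e_gt0.
Qed.

Lemma triangle_step2 a b (A : {set triangle}) c : v1 \notin A ->
  next_len a = 1 -> next_len b = 1 - e ->
  ale_step (State a b A) c = State a (traverse b) (heading b |: A)%SET.
Proof.
move=> v1A la lb; rewrite /ale_step la lb ifF; last first.
  by apply: contraNF v1A => /eqP->; rewrite inE.
rewrite ifF //; apply/negbTE; have := e_gt0.
rewrite negb_or negb_and -leNgt => ?.
by apply/andP; split; [lra | apply/orP; left; lra].
Qed.

(** One agent goes [v0], [v2], [v1], travelling 2 - 2e, and is then at distance at least 1 from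
    [v0]. *)
Lemma triangle_ale_cost (coins : #|triangle|.-tuple bool) :
  3 - 2 * e <= ale_cost v0 coins.
Proof.
pose a0 : agent triangle := Agent v1 v0 (0 + (1 - e) + (1 - e)).
have far : 3 - 2 * e <= total_cost v0 a0.
  by rewrite /total_cost /=; have := triangle_dist; lra.
rewrite /ale_cost le_max; apply/orP.
suff [-> | ->] : agent1 (ale_final v0 coins) = a0 \/
    agent2 (ale_final v0 coins) = a0; [by left | by right |].
have sz : size coins = 3%N by rewrite size_tuple card_ord.
rewrite /ale_final; case: (tval coins) sz => [|c1 [|c2 [|c3 [|//]]]] // _.
rewrite -[foldl _ _ _]/(ale_step (ale_step (ale_step _ c1) c2) c3) /ale_init.
(* Two steps visit all nodes, so the third coin changes nothing. *)
have stop a b c : ale_step (State a b (v1 |: (v2 |: [set v0])))%SET c =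
    State a b (v1 |: (v2 |: [set v0]))%SET.
  rewrite /= ifT //; apply/eqP/setP => v.
  by elim/triangle_cases: v; rewrite !inE !vE ?orbT.
have l01 t : next_len (Agent v0 v1 t) = 1 by rewrite /next_len triangle_lenE !vE.
have l02 t : next_len (Agent v0 v2 t) = 1 - e.
  by rewrite /next_len triangle_lenE !vE.
have l21 t : next_len (Agent v2 v1 t) = 1 - e.
  by rewrite /next_len triangle_lenE !vE.
have t02 t : traverse (Agent v0 v2 t) = Agent v2 v1 (t + (1 - e)).
  by rewrite /traverse l02 (triangle_onward _ _ v1) //= !vE.
have t21 t : traverse (Agent v2 v1 t) = Agent v1 v0 (t + (1 - e)).
  by rewrite /traverse l21 (triangle_onward _ _ v0) //= !vE.
have n0 : v1 \notin [set v0]%SET by rewrite !inE !vE.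
have n20 : v1 \notin [set v2; v0]%SET by rewrite !inE !vE.
(* Which agent sets out towards [v2] depends on the neighbour that [pick] returns. *)
case: pickP => [x|/(_ v1)]; last by rewrite triangle_adjE !vE.
elim/triangle_cases: x; rewrite triangle_adjE !vE // => _; rewrite [odflt _ _]/=.
  right; rewrite (triangle_onward _ _ v2) ?vE //.
  by rewrite triangle_step2 // t02 triangle_step2 // t21 stop.
left; rewrite (triangle_onward _ _ v1) ?vE //.
by rewrite triangle_step1 // t02 triangle_step1 // t21 stop.
Qed.

End Triangle.

(** * From the two bounds to the competitive ratio *)

Lemma ale_tight (R : realType) (e : R) : 0 < e -> e <= 1 / 2 ->
  exists (G : wgraph R) (s : G), [/\ is_cycle G, opt s 2 <= 2
    & forall coins : #|G|.-tuple bool, 3 - 2 * e <= ale_cost s coins].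
Proof.
move=> e_gt0 e_le; exists (triangle R e e_le); eexists; split.
- exact: triangle_cycle.
- exact: triangle_opt.
- exact: triangle_ale_cost.
Qed.

(** The cost is arbitrary so as to cover both fixed coins and the expectation. *)
Lemma competitive_ratio_three_halves (R : realType)
    (cost : forall G : wgraph R, G -> R) :
  (forall G s, is_cycle G -> cost G s <= 3 / 2 * opt s 2) ->
  (forall e, 0 < e -> e <= 1 / 2 -> exists (G : wgraph R) (s : G),
     [/\ is_cycle G, opt s 2 <= 2 & 3 - 2 * e <= cost G s]) ->
  competitive_ratio 2 (@is_cycle R) cost (3 / 2).
Proof.
move=> cost_le cost_ge; split.
  move=> _ [G [s [cG ->]]]; have := cost_le G s cG.
  have : 0 <= opt s 2.
    apply: opt_ge => // w [ws _]; have [p _] := ws ord0.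
    exact: le_trans (walk_len_ge0 _ _ _ _ p) (walk_len_le_energy _ _ _ _ w ord0).
  (* If [opt] is 0, the quotient is 0 by the convention for division. *)
  rewrite [0 <= _]le_eqVlt => /predU1P[<- _|opt0]; first by rewrite invr0 mulr0; lra.
  by rewrite ler_pdivrMr.
move=> u u_ub.
have near e : 0 < e -> e <= 1 / 2 -> 3 / 2 - e <= u.
  move=> e0 e1; have [G [s [cG opt2 cge]]] := cost_ge e e0 e1.
  have opt0 : 0 < opt s 2 by have := cost_le G s cG; lra.
  apply: (@le_trans _ _ (cost G s / opt s 2)); last by apply: u_ub; exists G, s.
  rewrite ler_pdivlMr //; apply: le_trans cge; nra.
rewrite leNgt; apply/negP => u_lt.
(* This bound makes the next choice of [e], half the gap between [u] and 3/2, at most 1/2. *)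
have u_ge : 1 <= u by have := near (1 / 2); lra.
by have := near ((3 / 2 - u) / 2); lra.
Qed.

Lemma sum_coins_const (R : realType) (n : nat) (c : R) :
  \sum_(t : n.-tuple bool) c = c * 2 ^+ n.
Proof. by rewrite sumr_const card_tuple card_bool -[c *+ _]mulr_natr natrX. Qed.

Lemma mean_le (R : realType) (n : nat) (F : n.-tuple bool -> R) (c : R) :
  (forall t, F t <= c) -> (\sum_t F t) / 2 ^+ n <= c.
Proof.
move=> Fc; rewrite ler_pdivrMr ?exprn_gt0 // -sum_coins_const.
exact: ler_sum.
Qed.

Lemma le_mean (R : realType) (n : nat) (F : n.-tuple bool -> R) (c : R) :
  (forall t, c <= F t) -> c <= (\sum_t F t) / 2 ^+ n.
Proof.
move=> Fc; rewrite ler_pdivlMr ?exprn_gt0 // -sum_coins_const.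
exact: ler_sum.
Qed.

Theorem theorem3 (R : realType) :
  (forall coins : (forall G : wgraph R, G -> #|G|.-tuple bool),
     competitive_ratio 2 (@is_cycle R)
       (fun G s => ale_cost s (coins G s)) (3 / 2)) /\
  competitive_ratio 2 (@is_cycle R)
    (fun G s => ale_expected_cost s) (3 / 2).
Proof.
split=> [coins|]; apply: competitive_ratio_three_halves => [G s cG|e e0 e1].
- exact: ale_cost_le.
- have [G [s [cG opt2 cost_ge]]] := ale_tight R e e0 e1.
  by exists G, s; split.
- by apply: mean_le => t; apply: ale_cost_le.
- have [G [s [cG opt2 cost_ge]]] := ale_tight R e e0 e1.
  by exists G, s; split=> //; apply: le_mean.
Qed.
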